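(* Let $m\ge 3$ be an odd integer and let $v\in\mathbb{F}_{2^{2m}}^*$ be a non-cube in $\mathbb{F}_{2^{2m}}^*$ with $v^{2^m+1}=1$. Then the monomial $v\,x^{2^{2m-1}+2^m+2^{m-1}-1}$ is a complete permutation polynomial over $\mathbb{F}_{2^{2m}}$.
   Context: A polynomial $f\in\mathbb{F}_Q[x]$ is a complete permutation polynomial over $\mathbb{F}_Q$ if both $f(x)$ and $f(x)+x$ induce bijections of $\mathbb{F}_Q$. *)

(* Defs.v *)
From mathcomp Require Import all_boot all_order all_algebra all_field.

Set Implicit Arguments.
Unset Strict Implicit.
Unset Printing Implicit Defensive.

Import GRing.Theory.
Local Open Scope ring_scope.

Definition permutation_poly (F : finFieldType) (f : {poly F}) : Prop :=
  bijective (fun x : F => f.[x]).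

Definition complete_permutation_poly (F : finFieldType) (f : {poly F}) : Prop :=
  permutation_poly f /\ permutation_poly (f + 'X).

Definition is_nonzero_cube (F : finFieldType) (v : F) : Prop :=
  exists2 w : F, w != 0 & v = w ^+ 3.

(* Main.v *)
Require Import Defs.
From mathcomp Require Import all_boot all_order all_algebra all_field.
From mathcomp Require Import zify ring.

(** Put [q = 2 ^ m]. Every nonzero [x] of the field with [q ^ 2] elements has a
    polar form [x = s * u] with [s ^+ q = s] and [u ^+ q.+1 = 1], and the Niho
    exponent [d] acts on it by [x ^+ d = s * u ^- 2]. Taking norms recovers [s],
    hence [u], from [v * x ^+ d]. The value [y = v * x ^+ d + x = s * (v * u ^- 2 + u)]
    satisfies [y ^+ q = v^-1 * u * y], so it determines [u] and then [s],
    provided that [y != 0]; and [y = 0] would give [v = u ^+ 3]. *)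

Import GRing.Theory.
Local Open Scope ring_scope.

(** Here and below [k.*2] stands for q, so the [k]-th power undoes squaring on elements fixed by the
    q-th power. The norm [x ^+ k.*2.+1] is such an element, and [s] is its square root. *)
Lemma polar_decomposition (F : finFieldType) (k : nat) (x : F) :
    #|F| = ((k.*2) ^ 2)%N -> x != 0 ->
  exists s u : F, [/\ s != 0, s ^+ k.*2 = s, u ^+ k.*2.+1 = 1 & x = s * u].
Proof.
move=> cardF x0; set s := x ^+ (k.*2.+1 * k).
have s0 : s != 0 by rewrite expf_neq0.
have xq2 : x ^+ (k.*2 * k.*2) = x by rewrite mulnn -cardF expf_card.
have normE : x ^+ (k.*2.+1 * k.*2) = x ^+ k.*2.+1.
  by rewrite mulSn exprD xq2 exprS mulrC.
have s2 : s ^+ 2 = x ^+ k.*2.+1 by rewrite -exprM -mulnA muln2 normE.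
have sq : s ^+ k.*2 = s.
  by rewrite -exprM -mulnA (mulnC k) mulnA exprM normE -exprM.
exists s, (x / s); split=> //; last by rewrite mulrC divfK.
by rewrite expr_div_n -s2 (exprS s k.*2) sq -expr2 divff ?expf_neq0.
Qed.

Lemma expr_unit_circle (F : fieldType) (q : nat) (u : F) :
  u ^+ q.+1 = 1 -> u != 0 /\ u ^+ q = u^-1.
Proof.
move=> uq; have u0 : u != 0.
  by apply: contra_eq_neq uq => ->; rewrite expr0n /= eq_sym oner_eq0.
by split=> //; apply: (mulfI u0); rewrite -exprS uq divff.
Qed.

(** The exponent is 1 modulo [k.*2.-1], which governs [s], and -2 modulo [k.*2.+1], which governs
    [u]. *)
Lemma niho_expr (F : fieldType) (k : nat) (s u : F) :
    (0 < k)%N -> s != 0 -> s ^+ k.*2 = s -> u ^+ k.*2.+1 = 1 ->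
  (s * u) ^+ (k.*2.+1 * k + k.*2.-1) = s * u ^- 2.
Proof.
move=> k0 s0 sq uq; have [u0 uV] := expr_unit_circle F _ _ uq.
have q0 : k.*2 = k.*2.-1.+1 by rewrite prednK ?double_gt0.
have sq1 : s ^+ k.*2.-1 = 1 by apply: (mulfI s0); rewrite -exprS -q0 sq mulr1.
have uq1 : u ^+ k.*2.-1 = u ^- 2.
  by apply: (mulfI u0); rewrite -exprS -q0 uV; field.
have sN : s ^+ (k.*2.+1 * k) = s.
  by rewrite exprM exprS sq -expr2 -exprM mul2n.
by rewrite exprMn (exprD s) (exprD u) sN sq1 exprM uq expr1n uq1 mulr1 mul1r.
Qed.

Section Niho.

Variables (F : fieldType) (k : nat) (v : F).
Hypothesis vq : v ^+ k.*2.+1 = 1.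

(** The norm of [s * u ^- 2] is [s ^+ 2]. Squares determine both factors, since [(s ^+ 2) ^+ k = s]
    and [(u ^+ 2) ^+ k = u^-1]. *)
Lemma niho_monomial_inj (s t u w : F) :
    s != 0 -> s ^+ k.*2 = s -> t ^+ k.*2 = t ->
    u ^+ k.*2.+1 = 1 -> w ^+ k.*2.+1 = 1 ->
  v * (s * u ^- 2) = v * (t * w ^- 2) -> s * u = t * w.
Proof.
move=> s0 sq tq uq wq.
have [v0 _] := expr_unit_circle F _ _ vq.
have [_ uV] := expr_unit_circle F _ _ uq.
have [_ wV] := expr_unit_circle F _ _ wq.
move/(mulfI v0) => e.
have normE (a b : F) : a ^+ k.*2 = a -> b ^+ k.*2.+1 = 1 ->
    (a * b ^- 2) ^+ k.*2.+1 = a ^+ 2.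
  by move=> aq bq; rewrite exprMn exprVn exprAC bq expr1n invr1 mulr1 exprS aq.
have st : s = t.
  by rewrite -sq -tq -mul2n !exprM -(normE s u) // -(normE t w) // e.
congr (_ * _) => //; move: e; rewrite -st => /(mulfI s0) /invr_inj e.
by apply: invr_inj; rewrite -uV -wV -mul2n !exprM e.
Qed.

Hypothesis char2 : 2%N \in [pchar F].

Lemma niho_binomial_inj (n : nat) (s t u w : F) :
    k.*2 = (2 ^ n)%N -> s ^+ k.*2 = s -> t ^+ k.*2 = t ->
    u ^+ k.*2.+1 = 1 -> w ^+ k.*2.+1 = 1 ->
    v * (s * u ^- 2) + s * u != 0 ->
  v * (s * u ^- 2) + s * u = v * (t * w ^- 2) + t * w -> s * u = t * w.
Proof.
move=> kE sq tq uq wq y0 e.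
have [v0 vV] := expr_unit_circle F _ _ vq.
have conjE (a b : F) : a ^+ k.*2 = a -> b ^+ k.*2.+1 = 1 ->
    (v * (a * b ^- 2) + a * b) ^+ k.*2 = v^-1 * b * (v * (a * b ^- 2) + a * b).
  move=> aq bq; have [b0 bV] := expr_unit_circle F _ _ bq.
  (* The q-th power is additive because [k.*2] is a power of the characteristic. *)
  rewrite {1}kE exprDn_pchar -?kE; last first.
    by rewrite kE (eq_pnat _ (pcharf_eq char2)) pnatX.
  by rewrite !exprMn exprVn exprAC vV aq bV; field; rewrite b0 v0 oner_neq0.
have uw : u = w.
  (* Equal values have equal conjugates; cancelling the nonzero value and [v^-1] leaves [u = w]. *)
  have := conjE s u sq uq; rewrite e conjE // -e => /(mulIf y0).
  by move/(mulfI (invr_neq0 v0)).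
move: e y0; rewrite -uw.
(* Now [s] and [t] multiply the same factor, which is nonzero because the value is. *)
have fE (a : F) : v * (a * u ^- 2) + a * u = a * (v * u ^- 2 + u) by ring.
by rewrite !fE mulf_eq0 negb_or => e /andP[_ c0]; rewrite (mulIf c0 e).
Qed.

End Niho.

Lemma niho_binomial_neq0 (F : finFieldType) (v s u : F) :
    2%N \in [pchar F] -> ~ is_nonzero_cube v -> s != 0 -> u != 0 ->
  v * (s * u ^- 2) + s * u != 0.
Proof.
move=> char2 hv s0 u0; apply/eqP => e; apply: hv; exists u => //.
have e3 : v * (s * u ^- 2) = s * u.
  by apply/eqP; rewrite -subr_eq0 (oppr_pchar2 char2) e.
have -> : v = v * (s * u ^- 2) * u ^+ 2 / s by field; rewrite u0 s0.
by rewrite e3; field.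
Qed.

(** Only nonzero elements have a polar form, so 0 is split off here. *)
Lemma inj_from_nonzero (F : nmodType) (f : F -> F) :
    f 0 = 0 -> (forall x, x != 0 -> f x != 0) ->
    (forall x y, x != 0 -> y != 0 -> f x = f y -> x = y) ->
  injective f.
Proof.
move=> f0 fN0 f_inj x y.
have [->|x0] := eqVneq x 0; have [->|y0] := eqVneq y 0 => //; last exact: f_inj.
  by move=> e; have := fN0 y y0; rewrite -e f0 eqxx.
by move=> e; have := fN0 x x0; rewrite e f0 eqxx.
Qed.

Theorem theorem9 (m : nat) (F : finFieldType) (v : F)
  (hm3 : (3 <= m)%N) (hmodd : odd m)
  (hF : #|F| = (2 ^ (2 * m))%N)
  (hv0 : v != 0)
  (hvcube : ~ is_nonzero_cube v)
  (hv : v ^+ (2 ^ m + 1)%N = 1) :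
  complete_permutation_poly
    (v *: 'X^(2 ^ (2 * m - 1) + 2 ^ m + 2 ^ (m - 1) - 1)%N).
Proof.
have m0 : (0 < m)%N by apply: leq_trans hm3.
set k := (2 ^ (m - 1))%N.
have k0 : (0 < k)%N by rewrite expn_gt0.
have qE : k.*2 = (2 ^ m)%N by rewrite -mul2n -expnS subn1 prednK.
have cardF : #|F| = (k.*2 ^ 2)%N by rewrite qE -expnM mulnC.
have char2 : 2%N \in [pchar F] by exact: card_finPcharP hF _.
(* Since [2 ^ (2 * m - 1)] is [k.*2 * k], the exponent regroups into the shape of [niho_expr]. *)
have dE : (2 ^ (2 * m - 1) + 2 ^ m + k - 1 = k.*2.+1 * k + k.*2.-1)%N.
  have -> : (2 * m - 1 = m + (m - 1))%N by lia.
  by rewrite expnD -qE -/k; nia.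
have vq : v ^+ k.*2.+1 = 1 by rewrite qE -addn1.
rewrite dE.
set d := (_ + _)%N.
have d0 : (0 < d)%N by rewrite addn_gt0 muln_gt0 k0.
have z0 : (0 : F) ^+ d = 0 by rewrite expr0n eqn0Ngt d0.
(* On a finite field injectivity suffices. The first three goals concern [v * x ^+ d], the last
   three [v * x ^+ d + x]. *)
split; apply: injF_bij; apply: inj_from_nonzero => [|x x0|x y x0 y0];
  rewrite !hornerE.
- by rewrite z0 mulr0.
- by rewrite mulf_neq0 ?expf_neq0.
- have [s [u [s0 sq uq ->]]] := polar_decomposition F k x cardF x0.
  have [t [w [t0 tq wq ->]]] := polar_decomposition F k y cardF y0.
  by rewrite !niho_expr //; apply: (niho_monomial_inj F k v vq).
- by rewrite z0 mulr0.
- have [s [u [s0 sq uq ->]]] := polar_decomposition F k x cardF x0.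
  have [u0 _] := expr_unit_circle F _ _ uq.
  by rewrite niho_expr //; apply: niho_binomial_neq0.
have [s [u [s0 sq uq ->]]] := polar_decomposition F k x cardF x0.
have [t [w [t0 tq wq ->]]] := polar_decomposition F k y cardF y0.
have [u0 _] := expr_unit_circle F _ _ uq.
rewrite !niho_expr //; apply: (niho_binomial_inj F k v vq char2 m) => //.
exact: niho_binomial_neq0.
Qed.
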